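(* Let $u$ be the solution of the parametric problem, $u_{h_k}$ ($k\in\mathbb N_0$) its finite element approximations, $\psi:H^1_0(D)\to\mathbb R$ a functional with $\psi(0)=0$, $\mathcal I_M$ ($M\in\mathbb N$) the interpolation operators, $\psi^{(\mathrm{ML})}_K[u]$ the multilevel approximation of $\psi(u)$, and $C_k$, $C^{(\mathrm{ML})}$ the costs, all as described in the context. Suppose there exist positive constants $\alpha,\beta,\mu,\gamma,C_s,C_I,C_\zeta,C_c$ and a real-valued function $\zeta$ such that $\alpha\ge\min(\beta,\mu\gamma)$ and, for all $k\in\mathbb N_0$, (F1) $|\mathbb E[\psi(u)-\psi(u_{h_k})]|\le C_s\,h_k^\alpha$; (F2) $\big|\mathbb E\big[\psi(u_{h_k})-\psi(u_{h_{k-1}})-\mathcal I_{M}(\psi(u_{h_k})-\psi(u_{h_{k-1}}))\big]\big|\le C_I\,M^{-\mu}\,\zeta(\psi(u_{h_k})-\psi(u_{h_{k-1}}))$ for all $M\in\mathbb N$; (F3) $\zeta(\psi(u_{h_k})-\psi(u_{h_{k-1}}))\le C_\zeta\,h_k^\beta$; (F4) $C_k=C_c\,h_k^{-\gamma}$. Then, for any $0<\varepsilon<\exp[-1]$, there exist an integer $K$ and numbers of interpolation points $M_0\le M_1\le\dots\le M_K$ such that $$\big|\mathbb E\big[\psi(u)-\psi^{(\mathrm{ML})}_K[u]\big]\big|\le\varepsilon,$$ and the computational cost $C^{(\mathrm{ML})}_\varepsilon:=C^{(\mathrm{ML})}$ of this approximation satisfies $$C^{(\mathrm{ML})}_\varepsilon\lesssim\begin{cases}\varepsilon^{-\frac1\mu},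 & \text{if }\beta>\mu\gamma,\\[1ex] \varepsilon^{-\frac1\mu}|\log\varepsilon|^{1+\frac1\mu}, & \text{if }\beta=\mu\gamma,\\[1ex] \varepsilon^{-\frac1\mu-\frac{\gamma\mu-\beta}{\alpha\mu}}, & \text{if }\beta<\mu\gamma.\end{cases}$$
   Context: Setting. $D\subset\mathbb R^d$ ($d=1,2,3$) is a bounded Lipschitz domain, $\Gamma=[-1,1]^N$, and $\rho\in L^\infty(\Gamma)$ is a product probability density on $\Gamma$; $\mathbb E[g]=\int_\Gamma g(\bm y)\rho(\bm y)\,\mathrm d\bm y$ (all expectations occurring are assumed to be well defined). The coefficient $a(\bm y,\mathbf x)$ satisfies $0<a_{\min}\le a(\bm y,\mathbf x)\le a_{\max}<\infty$ for almost every $\bm y$ and all $\mathbf x\in\overline D$, and $f\in L^2_\rho(\Gamma;H^{-1}(D))$. The function $u\in L^2_\rho(\Gamma;H^1_0(D))$ is the unique solution of $-\nabla\cdot(a(\bm y,\mathbf x)\nabla u(\bm y,\mathbf x))=f(\bm y,\mathbf x)$ in $D$, $u(\bm y,\cdot)=0$ on $\partial D$; it is assumed that $u\in C^0(\Gamma;H^1_0(D))$. For a function $v$ on $\Gamma$ with values in $H^1_0(D)$, $\psi(v)$ denotes the real-valued function $\bm y\mapsto\psi(v(\bm y,\cdot))$ on $\Gamma$. The function $\zeta$ is defined on a class of functions on $\Gamma$ containing all $\psi(u_{h_k})-\psi(u_{h_{k-1}})$. Spatial approximation. $V_{h_0}\subset V_{h_1}\subset\dots\subset H^1_0(D)$ are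 nested finite element spaces of continuous piecewise polynomials on shape-regular triangulations with maximum mesh width $h_k=\eta^{-k}h_0$, for some integer $\eta>1$. $u_{h_k}(\bm y,\cdot)\in V_{h_k}$ is the Galerkin finite element approximation of $u(\bm y,\cdot)$. Set $u_{h_{-1}}:=0$. Interpolation. For $M\in\mathbb N$, $\mathcal I_M:C^0(\Gamma)\to L^2_\rho(\Gamma)$ is an interpolation operator using $M$ points $\bm y_1,\dots,\bm y_M\in\Gamma$: $\mathcal I_M[g]=\sum_{m=1}^M c_m\phi_m$, where $\{\phi_m\}_{m=1}^M\subset L^2_\rho(\Gamma)$ is a basis of the $M$-dimensional interpolation space and the $c_m\in\mathbb R$ are determined by $\mathcal I_M[g](\bm y_m)=g(\bm y_m)$, $m=1,\dots,M$. Multilevel approximation and cost. Given $K$ and $M_0,\dots,M_K\in\mathbb N$, $$\psi^{(\mathrm{ML})}_K[u]:=\sum_{k=0}^K\mathcal I_{M_{K-k}}\big(\psi(u_{h_k})-\psi(u_{h_{k-1}})\big).$$ $C_k$ is the cost of computing one sample of the level-$k$ difference at a point of $\Gamma$, and the total computational cost is $C^{(\mathrm{ML})}=\sum_{k=0}^K M_{K-k}C_k$. The notation $A\lesssim B$ means $A\le cB$ with a constant $c>0$ independent of $\varepsilon$. *)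

(* Defs.v *)
From HB Require Import structures.
From mathcomp Require Import all_boot all_order all_algebra.
From mathcomp Require Import all_classical all_reals all_analysis.
Set Implicit Arguments.
Unset Strict Implicit.
Unset Printing Implicit Defensive.
Import Order.TTheory GRing.Theory Num.Theory.
Import numFieldNormedType.Exports.
Local Open Scope classical_set_scope.
Local Open Scope ring_scope.

(* R^n is ['rV[R]_n] with the product sigma-algebra; Lebesgue measure on it is
   the iterated product of [lebesgue_measure], see [lebesgue_rV] and its value
   on boxes in [lebesgue_rV_box]. *)
Definition rV_coord (R : realType) (n : nat) (i : 'I_n) (x : 'rV[R]_n) : R :=
  x ord0 i.

Lemma rV_measurable0 (R : realType) (n : nat) :
  g_sigma_preimage (@rV_coord R n) set0.
Proof. exact: sigma_algebra0. Qed.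

Lemma rV_measurableC (R : realType) (n : nat) (A : set 'rV[R]_n) :
  g_sigma_preimage (@rV_coord R n) A -> g_sigma_preimage (@rV_coord R n) (~` A).
Proof. exact: sigma_algebraC. Qed.

Lemma rV_measurable_bigcup (R : realType) (n : nat) (F : (set 'rV[R]_n)^nat) :
  (forall i, g_sigma_preimage (@rV_coord R n) (F i)) ->
  g_sigma_preimage (@rV_coord R n) (\bigcup_i F i).
Proof. exact: sigma_algebra_bigcup. Qed.

HB.instance Definition _ (R : realType) (n : nat) :=
  @isMeasurable.Build default_measure_display 'rV[R]_n
    (g_sigma_preimage (@rV_coord R n)) (@rV_measurable0 R n)
    (@rV_measurableC R n) (@rV_measurable_bigcup R n).

Lemma measurable_rV_coord (R : realType) (n : nat) (i : 'I_n) :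
  measurable_fun [set: 'rV[R]_n] (@rV_coord R n i).
Proof.
move=> _ Y mY; rewrite setTI; apply: sub_sigma_algebra => /=.
rewrite -bigcup_seq/=; exists i => /=; first by rewrite mem_index_enum.
by exists Y => //; rewrite setTI.
Qed.

Lemma measurable_fun_rVP d (T : measurableType d) (R : realType) (n : nat)
    (f : T -> 'rV[R]_n) :
  (forall i, measurable_fun [set: T] (@rV_coord R n i \o f)) ->
  measurable_fun [set: T] f.
Proof.
move=> mf; suff H : g_sigma_preimage (fun i => @rV_coord R n i \o f)
    `<=` measurable.
  rewrite g_sigma_preimage_comp in H.
  by move=> _ A mA; apply: H; exists A.
apply: smallest_sub; first exact: sigma_algebra_measurable.
case: n => [|n] in f mf *; first by rewrite big_ord0.
rewrite -bigcup_mkord_ord; apply: bigcup_sub => i Ii.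
by move=> A [B mB <-]; exact: mf.
Qed.

Definition rV_cons (R : realType) (n : nat) (p : measurableTypeR R * 'rV[R]_n) : 'rV[R]_n.+1 :=
  \row_i (if unlift ord0 i is Some j then p.2 ord0 j else p.1).

Definition rV_uncons (R : realType) (n : nat) (x : 'rV[R]_n.+1) :
    measurableTypeR R * 'rV[R]_n :=
  (x ord0 ord0, \row_j x ord0 (lift ord0 j)).

Lemma rV_consK (R : realType) (n : nat) : cancel (@rV_cons R n) (@rV_uncons R n).
Proof.
move=> [a v]; congr pair; first by rewrite mxE unlift_none.
by apply/rowP => j; rewrite !mxE liftK.
Qed.

Lemma rV_unconsK (R : realType) (n : nat) : cancel (@rV_uncons R n) (@rV_cons R n).
Proof.
by move=> x; apply/rowP => i; rewrite mxE; case: unliftP => [j|] -> //=; rewrite mxE.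
Qed.

Lemma measurable_rV_cons (R : realType) (n : nat) :
  measurable_fun [set: measurableTypeR R * 'rV[R]_n] (@rV_cons R n).
Proof.
apply: measurable_fun_rVP => i.
case: (unliftP ord0 i) => [j|] ->.
  rewrite (_ : _ \o _ = @rV_coord R n j \o snd).
    by apply: measurableT_comp; [exact: measurable_rV_coord|exact: measurable_snd].
  by apply/funext => p /=; rewrite /rV_coord /rV_cons mxE liftK.
rewrite (_ : _ \o _ = fst); first exact: measurable_fst.
by apply/funext => p /=; rewrite /rV_coord /rV_cons mxE unlift_none.
Qed.

Lemma measurable_rV_uncons (R : realType) (n : nat) :
  measurable_fun [set: 'rV[R]_n.+1] (@rV_uncons R n).
Proof.
apply: measurable_fun_pair; first exact: measurable_rV_coord.
apply: measurable_fun_rVP => i.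
rewrite (_ : _ \o _ = @rV_coord R n.+1 (lift ord0 i)).
  exact: measurable_rV_coord.
by apply/funext => x /=; rewrite /rV_coord mxE.
Qed.

Definition lebesgue_step (R : realType) (n : nat)
    (m : {sigma_finite_measure set 'rV[R]_n -> \bar R}) :
    set 'rV[R]_n.+1 -> \bar R :=
  pushforward (@lebesgue_measure R \x m)%E (@rV_cons R n).

Lemma lebesgue_step0 (R : realType) (n : nat)
    (m : {sigma_finite_measure set 'rV[R]_n -> \bar R}) :
  lebesgue_step m set0 = 0%E.
Proof. by rewrite /lebesgue_step /pushforward preimage_set0 measure0. Qed.

Lemma lebesgue_step_ge0 (R : realType) (n : nat)
    (m : {sigma_finite_measure set 'rV[R]_n -> \bar R}) (A : set 'rV[R]_n.+1) :
  (0 <= lebesgue_step m A)%E.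
Proof. by rewrite /lebesgue_step /pushforward measure_ge0. Qed.

Lemma lebesgue_step_sigma_additive (R : realType) (n : nat)
    (m : {sigma_finite_measure set 'rV[R]_n -> \bar R}) :
  semi_sigma_additive (lebesgue_step m).
Proof.
have mc := @measurable_rV_cons R n.
move=> F mF tF mUF; rewrite /lebesgue_step /pushforward preimage_bigcup.
apply: measure_semi_sigma_additive.
- by move=> i; rewrite -[X in measurable X]setTI; exact: mc.
- apply/trivIsetP => /= i j _ _ ij; rewrite -preimage_setI.
  by move/trivIsetP : tF => /(_ _ _ _ _ ij) ->//; rewrite preimage_set0.
- by rewrite -preimage_bigcup -[X in measurable X]setTI; exact: mc.
Qed.

HB.instance Definition _ (R : realType) (n : nat)
    (m : {sigma_finite_measure set 'rV[R]_n -> \bar R}) :=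
  isMeasure.Build _ _ _ (lebesgue_step m) (lebesgue_step0 m)
    (lebesgue_step_ge0 m) (@lebesgue_step_sigma_additive R n m).

Lemma lebesgue_step_sigma_finite (R : realType) (n : nat)
    (m : {sigma_finite_measure set 'rV[R]_n -> \bar R}) :
  sigma_finite [set: 'rV[R]_n.+1] (lebesgue_step m).
Proof.
have /sigma_finiteP[F [FT ndF Foo]] := sigma_finiteT (@lebesgue_measure R).
have /sigma_finiteP[G [GT ndG Goo]] := sigma_finiteT m.
exists (fun i => @rV_uncons R n @^-1` (F i `*` G i)).
  rewrite -preimage_bigcup; apply/esym; rewrite -subTset => x _ /=.
  have [k _ Fk] : (\bigcup_i F i) (rV_uncons x).1 by rewrite -FT.
  have [l _ Gl] : (\bigcup_i G i) (rV_uncons x).2 by rewrite -GT.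
  exists (maxn k l) => //; split.
  - by move: Fk; exact/subsetPset/ndF/leq_maxl.
  - by move: Gl; exact/subsetPset/ndG/leq_maxr.
move=> i; have [mF Fi] := Foo i; have [mG Gi] := Goo i; split.
  rewrite -[X in measurable X]setTI; apply: measurable_rV_uncons => //.
  exact: measurableX.
rewrite /lebesgue_step /pushforward -comp_preimage.
rewrite (_ : _ \o _ = id) ?preimage_id; last first.
  by apply/funext => p /=; rewrite rV_consK.
rewrite product_measure1E// lte_mul_pinfty// ge0_fin_numE//.
Qed.

HB.instance Definition _ (R : realType) (n : nat)
    (m : {sigma_finite_measure set 'rV[R]_n -> \bar R}) :=
  Measure_isSigmaFinite.Build _ _ _ (lebesgue_step m)
    (lebesgue_step_sigma_finite m).

Fixpoint lebesgue_rV (R : realType) (n : nat) :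
    {sigma_finite_measure set 'rV[R]_n -> \bar R} :=
  if n is n'.+1 then lebesgue_step (lebesgue_rV R n') else \d_(0 : 'rV[R]_0).

Lemma lebesgue_rV_box (R : realType) (n : nat) (a b : 'I_n -> R) :
  lebesgue_rV R n [set x : 'rV[R]_n | forall i, x ord0 i \in `[a i, b i]] =
  (\prod_(i < n) lebesgue_measure `[a i, b i])%E.
Proof.
elim: n a b => [|n IH] a b.
  by rewrite big_ord0 /= diracE mem_set//=; case.
rewrite big_ord_recl -(IH (a \o lift ord0) (b \o lift ord0)).
set B := (X in lebesgue_rV R n X).
have mB : measurable B.
  rewrite (_ : B = \bigcap_(i in [set: 'I_n])
      (@rV_coord R n i @^-1` `[a (lift ord0 i), b (lift ord0 i)])).
    apply: fin_bigcap_measurable => // i _; rewrite -[X in measurable X]setTI.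
    exact: measurable_rV_coord.
  by apply/seteqP; split=> [x Bx i _|x Bx i]; [exact: Bx|exact: (Bx i I)].
rewrite /= /lebesgue_step /pushforward -product_measure1E//.
congr (_ _); apply/seteqP; split=> -[y x] /=.
  move=> abx; split=> [|i]; first by have := abx ord0; rewrite mxE unlift_none.
  by have := abx (lift ord0 i); rewrite mxE liftK.
by move=> [ay abx] i; rewrite mxE; case: unliftP => [j|] -> //; exact: abx.
Qed.

(* The library norm of ['rV[R]_d] is the maximum norm. *)
Definition dotv (R : realType) (d : nat) (x y : 'rV[R]_d) : R :=
  \sum_i x ord0 i * y ord0 i.

Definition enorm (R : realType) (d : nat) (x : 'rV[R]_d) : R :=
  Num.sqrt (dotv x x).

Definition eball (R : realType) (d : nat) (x : 'rV[R]_d) (r : R) : set 'rV[R]_d :=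
  [set y | enorm (y - x) < r].

Definition diameter (R : realType) (d : nat) (A : set 'rV[R]_d) : R :=
  sup [set enorm (q.1 - q.2) | q in A `*` A].

(* Near each boundary point, [D] is the strict epigraph, in the direction of a
   unit vector [e], of a Lipschitz function of the component orthogonal to [e]. *)
Definition lipschitz_boundary (R : realType) (d : nat) (D : set 'rV[R]_d) :=
  forall x0, (closure D `\` D°) x0 ->
  exists (r L : R) (e : 'rV[R]_d) (g : 'rV[R]_d -> R),
    [/\ 0 < r, enorm e = 1,
        forall x y, `|g x - g y| <= L * enorm (x - y) &
        forall x, eball x0 r x -> (D x <-> g (x - dotv x e *: e) < dotv x e)].

Definition bounded_lipschitz_domain (R : realType) (d : nat) (D : set 'rV[R]_d) :=
  [/\ D !=set0, open D, connected D, bounded_set D & lipschitz_boundary D].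

(* Functions on [D] are total functions on R^d of which only the values on [D]
   matter; elements of L^2(D), H^1(D) and H^1_0(D) are representatives, equality
   in these spaces being equality almost everywhere on [D]. *)
Definition ae_eq_on (R : realType) (d : nat) (D : set 'rV[R]_d) (v w : 'rV[R]_d -> R) :=
  {ae lebesgue_rV R d, forall x, D x -> v x = w x}.

Definition L2on (R : realType) (d : nat) (D : set 'rV[R]_d) (v : 'rV[R]_d -> R) :=
  measurable_fun D v /\
  (lebesgue_rV R d).-integrable D (fun x => (v x ^+ 2)%:E).

Definition partial (R : realType) (d : nat) (i : 'I_d) (f : 'rV[R]_d -> R) :
    'rV[R]_d -> R :=
  fun x => 'D_(delta_mx ord0 i : 'rV[R]_d) f x.

Definition smooth (R : realType) (d : nat) (f : 'rV[R]_d -> R) :=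
  forall (s : seq 'I_d) x, differentiable (foldr (@partial R d) f s) x.

Definition test_function (R : realType) (d : nat) (D : set 'rV[R]_d)
    (phi : 'rV[R]_d -> R) :=
  [/\ smooth phi, compact (closure [set x | phi x != 0]) &
      closure [set x | phi x != 0] `<=` D].

Definition is_weak_partial (R : realType) (d : nat) (D : set 'rV[R]_d) (i : 'I_d)
    (v w : 'rV[R]_d -> R) :=
  forall phi, test_function D phi ->
  \int[lebesgue_rV R d]_(x in D) (v x * partial i phi x) =
  - \int[lebesgue_rV R d]_(x in D) (w x * phi x).

Definition H1 (R : realType) (d : nat) (D : set 'rV[R]_d) : set ('rV[R]_d -> R) :=
  [set v | L2on D v /\ forall i, exists2 w, L2on D w & is_weak_partial D i v w].

(* The weak partial derivative is unique up to a null set; this chooses one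
   representative in L^2(D). *)
Definition weak_partial (R : realType) (d : nat) (D : set 'rV[R]_d) (i : 'I_d)
    (v : 'rV[R]_d -> R) : 'rV[R]_d -> R :=
  xget (fun=> 0) [set w | L2on D w /\ is_weak_partial D i v w].

Definition H1norm (R : realType) (d : nat) (D : set 'rV[R]_d) (v : 'rV[R]_d -> R) : R :=
  Num.sqrt (\int[lebesgue_rV R d]_(x in D) (v x ^+ 2) +
    \sum_i \int[lebesgue_rV R d]_(x in D) (weak_partial D i v x ^+ 2)).

Definition H10 (R : realType) (d : nat) (D : set 'rV[R]_d) : set ('rV[R]_d -> R) :=
  [set v | H1 D v /\ forall e, 0 < e ->
     exists2 phi, test_function D phi & H1norm D (v - phi) < e].

Definition Hminus1 (R : realType) (d : nat) (D : set 'rV[R]_d) :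
    set (('rV[R]_d -> R) -> R) :=
  [set F | (forall a v w, H10 D v -> H10 D w -> F (a *: v + w) = a * F v + F w) /\
     exists C, forall v, H10 D v -> `|F v| <= C * H1norm D v].

Definition Hminus1_norm (R : realType) (d : nat) (D : set 'rV[R]_d)
    (F : ('rV[R]_d -> R) -> R) : R :=
  sup [set `|F v| | v in [set v | H10 D v /\ H1norm D v <= 1]].

Definition Gamma (R : realType) (N : nat) : set 'rV[R]_N :=
  [set y | forall i, y ord0 i \in `[-1, 1]].

Definition product_density (R : realType) (N : nat) (rho : 'rV[R]_N -> R) :=
  exists r : 'I_N -> R -> R,
    (forall i, [/\ measurable_fun (`[-1, 1] : set R) (r i),
        forall t, t \in `[-1, 1] -> 0 <= r i t &
        \int[lebesgue_measure]_(t in `[-1, 1]) r i t = 1]) /\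
    forall y, Gamma y -> rho y = \prod_i r i (y ord0 i).

Definition ess_bounded (R : realType) (N : nat) (rho : 'rV[R]_N -> R) :=
  exists C, {ae lebesgue_rV R N, forall y, Gamma y -> `|rho y| <= C}.

(* Almost everywhere on [Gamma] for the probability measure [rho(y) dy]. *)
Definition rho_ae (R : realType) (N : nat) (rho : 'rV[R]_N -> R)
    (P : 'rV[R]_N -> Prop) :=
  {ae lebesgue_rV R N, forall y, Gamma y -> rho y != 0 -> P y}.

Definition expectation_exists (R : realType) (N : nat) (rho g : 'rV[R]_N -> R) :=
  (lebesgue_rV R N).-integrable (@Gamma R N) (fun y => (g y * rho y)%:E).

Definition expect (R : realType) (N : nat) (rho g : 'rV[R]_N -> R) : R :=
  \int[lebesgue_rV R N]_(y in @Gamma R N) (g y * rho y).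

Definition L2rho (R : realType) (N : nat) (rho g : 'rV[R]_N -> R) :=
  measurable_fun (@Gamma R N) g /\ expectation_exists rho (fun y => g y ^+ 2).

(* Strong measurability with values in the (semi)normed space [S], as almost
   everywhere limit of measurable functions with finitely many values. *)
Definition strongly_measurable (R : realType) (N : nat) (rho : 'rV[R]_N -> R)
    (X : zmodType) (S : set X) (nrm : X -> R) (v : 'rV[R]_N -> X) :=
  exists s : nat -> 'rV[R]_N -> X,
    (forall n, [/\ finite_set (s n @` @Gamma R N), s n @` @Gamma R N `<=` S &
       forall x, measurable (@Gamma R N `&` s n @^-1` [set x])]) /\
    rho_ae rho (fun y => (fun n => nrm (s n y - v y)) @ \oo --> (0 : R)).

Definition bochner_L2rho (R : realType) (N : nat) (rho : 'rV[R]_N -> R)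
    (X : zmodType) (S : set X) (nrm : X -> R) (v : 'rV[R]_N -> X) :=
  [/\ v @` @Gamma R N `<=` S, strongly_measurable rho S nrm v &
      (\int[lebesgue_rV R N]_(y in @Gamma R N) ((nrm (v y) ^+ 2 * rho y)%:E) < +oo)%E].

Definition continuous_on_Gamma (R : realType) (N : nat)
    (X : zmodType) (S : set X) (nrm : X -> R) (v : 'rV[R]_N -> X) :=
  v @` @Gamma R N `<=` S /\ forall y0, Gamma y0 ->
    (fun y => nrm (v y - v y0)) @ within (@Gamma R N) (nbhs y0) --> (0 : R).

Definition diffusion_form (R : realType) (d : nat) (D : set 'rV[R]_d)
    (A v w : 'rV[R]_d -> R) : R :=
  \int[lebesgue_rV R d]_(x in D)
    (A x * \sum_i (weak_partial D i v x * weak_partial D i w x)).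

(* The Galerkin solution in the space [V]; the weak solution of the boundary
   value problem is the case [V = H10 D]. *)
Definition galerkin_solution (R : realType) (d : nat) (D : set 'rV[R]_d)
    (V : set ('rV[R]_d -> R)) (A : 'rV[R]_d -> R) (F : ('rV[R]_d -> R) -> R)
    (v : 'rV[R]_d -> R) :=
  V v /\ forall w, V w -> diffusion_form D A v w = F w.

(* A simplex is given by its vertices; [face P J] is spanned by the vertices
   with index in [J], and is empty when [J] is. *)
Definition face (R : realType) (d : nat) (P : 'I_d.+1 -> 'rV[R]_d)
    (J : {set 'I_d.+1}) : set 'rV[R]_d :=
  [set x | exists l : 'I_d.+1 -> R,
     [/\ forall i, 0 <= l i, forall i, i \notin J -> l i = 0,
         \sum_i l i = 1 & x = \sum_i l i *: P i]].

Definition simplex (R : realType) (d : nat) (P : 'I_d.+1 -> 'rV[R]_d) :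
    set 'rV[R]_d := face P [set: 'I_d.+1]%SET.

(* The elements lie in the closure of [D] but need not cover it, since a
   Lipschitz domain need not be a polytope. *)
Definition triangulation (R : realType) (d : nat) (D : set 'rV[R]_d)
    (T : set ('I_d.+1 -> 'rV[R]_d)) :=
  [/\ finite_set T, forall P, T P -> simplex P `<=` closure D &
      forall P Q, T P -> T Q -> exists J J' : {set 'I_d.+1},
        simplex P `&` simplex Q = face P J /\ simplex P `&` simplex Q = face Q J'].

Definition max_mesh_width (R : realType) (d : nat)
    (T : set ('I_d.+1 -> 'rV[R]_d)) (h : R) :=
  (exists2 P, T P & diameter (simplex P) = h) /\
  (forall P, T P -> diameter (simplex P) <= h).

Definition shape_regular (R : realType) (d : nat)
    (T : nat -> set ('I_d.+1 -> 'rV[R]_d)) :=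
  exists kappa : R, forall k P, T k P -> exists (x : 'rV[R]_d) (r : R),
    [/\ 0 < r, eball x r `<=` simplex P & diameter (simplex P) <= kappa * r].

Definition polynomial_on (R : realType) (d p : nat) (A : set 'rV[R]_d)
    (v : 'rV[R]_d -> R) :=
  exists c : {ffun 'I_d -> 'I_p.+1} -> R, forall x, A x ->
    v x = \sum_(m : {ffun 'I_d -> 'I_p.+1} | (\sum_i m i <= p)%N)
            c m * \prod_i x ord0 i ^+ m i.

Definition piecewise_polynomial (R : realType) (d p : nat)
    (T : set ('I_d.+1 -> 'rV[R]_d)) (v : 'rV[R]_d -> R) :=
  (forall P, T P -> polynomial_on p (simplex P) v) /\
  (forall x, ~ (\bigcup_(P in T) simplex P) x -> v x = 0).

Definition fe_space (R : realType) (d p : nat) (D : set 'rV[R]_d)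
    (T : set ('I_d.+1 -> 'rV[R]_d)) (V : set ('rV[R]_d -> R)) :=
  [/\ V (fun=> 0), forall a v w, V v -> V w -> V (a *: v + w), V `<=` H10 D &
      forall v, V v ->
        {within closure D, continuous v} /\ piecewise_polynomial p T v].

(* [op] is the interpolation operator given by points in [Gamma] and a basis in
   L^2_rho of the interpolation space for which interpolation is uniquely
   solvable. Only point values enter, so [op] applies to all functions. *)
Definition interpolation_operator (R : realType) (N : nat) (rho : 'rV[R]_N -> R)
    (M : nat) (op : ('rV[R]_N -> R) -> ('rV[R]_N -> R)) :=
  exists (pts : 'I_M -> 'rV[R]_N) (phi : 'I_M -> 'rV[R]_N -> R),
    [/\ forall m, Gamma (pts m),
        forall m, L2rho rho (phi m),
        forall c : 'I_M -> R,
          rho_ae rho (fun y => \sum_m c m * phi m y = 0) -> forall m, c m = 0,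
        forall b : 'I_M -> R, exists! c : 'rV[R]_M,
          forall m, \sum_j c ord0 j * phi j (pts m) = b m &
        forall g, exists c : 'I_M -> R,
          (forall y, op g y = \sum_m c m * phi m y) /\
          (forall m, op g (pts m) = g (pts m))].

(* [u_{h_{-1}} = 0]. *)
Definition level_difference (R : realType) (d N : nat) (psi : ('rV[R]_d -> R) -> R)
    (uh : nat -> 'rV[R]_N -> 'rV[R]_d -> R) (k : nat) : 'rV[R]_N -> R :=
  fun y => psi (uh k y) - psi (if k is k'.+1 then uh k' y else fun=> 0).

Definition multilevel (R : realType) (d N : nat) (psi : ('rV[R]_d -> R) -> R)
    (uh : nat -> 'rV[R]_N -> 'rV[R]_d -> R)
    (I : nat -> ('rV[R]_N -> R) -> ('rV[R]_N -> R)) (K : nat) (M : nat -> nat) :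
    'rV[R]_N -> R :=
  fun y => \sum_(k < K.+1) I (M (K - k)%N) (level_difference psi uh k) y.

Definition total_cost (R : realType) (C : nat -> R) (K : nat) (M : nat -> nat) : R :=
  \sum_(k < K.+1) (M (K - k)%N)%:R * C k.

Definition cost_rate (R : realType) (alpha beta mu gamma eps : R) : R :=
  if mu * gamma < beta then eps `^ (- mu^-1)
  else if beta == mu * gamma then eps `^ (- mu^-1) * `|ln eps| `^ (1 + mu^-1)
  else eps `^ (- mu^-1 - (gamma * mu - beta) / (alpha * mu)).

(* Main.v *)
Require Import Defs.
From mathcomp Require Import all_boot all_order all_algebra.
From mathcomp Require Import all_classical all_reals all_analysis.
From mathcomp Require Import ring lra.
Import Order.TTheory GRing.Theory Num.Theory.
Import numFieldNormedType.Exports.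
Local Open Scope classical_set_scope.
Local Open Scope ring_scope.

(** Write [q = eta^-1], so that [h_k] is a multiple of [q^k].  The differences
    [psi(u_{h_k}) - psi(u_{h_{k-1}})] telescope to [psi(u_{h_K})], hence the
    error of the multilevel approximation is the discretisation error on the
    finest level plus the sum over the levels of the interpolation errors of the
    differences ([multilevel_error_le]).  Up to constants it is at most
      [q^(alpha K) + sum_(k <= K) m_k^(-mu) q^(beta k)],
    where [m_k = M_{K-k}] points are used on level [k], and the cost is a
    multiple of [sum_(k <= K) m_k q^(-gamma k)].  What remains is an optimisation
    problem for numbers ([multilevel_parameters]).

    The integer [K] is the first one for which the discretisation error is at
    most [eps / 2]; minimality gives [q^(-K) <= c eps^(-1/alpha)] and so
    [K + 1 <= c |log eps|] ([finest_level]).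

    For fixed [K], minimising the cost at a prescribed interpolation error by
    Lagrange multipliers suggests real sample numbers
    [x_k = X q^(delta k)] with [delta = (beta + gamma) / (1 + mu)].  For this
    exponent the error sum and the cost sum become [X^(-mu) S] and [X S] with
    the same geometric sum [S = sum_(k <= K) q^(theta k)],
    [theta = (beta - gamma mu) / (1 + mu)].  A tolerance [t] for the error
    forces [X = (S / t)^(1/mu)], and rounding up costs at most one further
    sample per level ([sample_allocation]).  The total cost is thus
      [t^(-1/mu) S^(1 + 1/mu) + sum_(k <= K) q^(-gamma k)]   with [t ~ eps].

    The three regimes come from the sign of [theta].  If it is positive, [S] is
    bounded; if it is zero, [S = K + 1] is logarithmic in [eps]; if it is
    negative, [S] is comparable with its last term [q^(theta K)], a power of
    [eps] by the choice of [K] ([weighted_sample_rate]).  The rounding term is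
    comparable with [q^(-gamma K)], hence at most of order [eps^(-gamma/alpha)],
    and the hypothesis [min(beta, mu gamma) <= alpha] ensures that this does not
    exceed the claimed rate ([finest_sample_rate]). *)

(** * Real powers and geometric sums *)

Lemma powR_lt1 (R : realType) (q s : R) : 0 < q < 1 -> 0 < s -> q `^ s < 1.
Proof.
move=> q01 s0; rewrite -[ltRHS]expR0 /powR gt_eqF; last by case/andP: q01.
by rewrite ltr_expR pmulr_rlt0// ln_lt0.
Qed.

Lemma powR_exprAC (R : realType) (q s : R) (k : nat) :
  0 <= q -> (q ^+ k) `^ s = (q `^ s) ^+ k.
Proof.
by move=> q0; rewrite -powR_mulrn// powRAC powR_mulrn// powR_ge0.
Qed.

Lemma geometric_sum_lt1 (R : realType) (x : R) (K : nat) :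
  0 <= x < 1 -> \sum_(k < K.+1) x ^+ k <= (1 - x)^-1.
Proof.
move=> /andP[x0 x1]; have x1' : 0 < 1 - x by rewrite subr_gt0.
rewrite -[leRHS]mul1r ler_pdivlMr// mulrC.
have -> : (1 - x) * (\sum_(k < K.+1) x ^+ k) = 1 - x ^+ K.+1.
  by apply: oppr_inj; rewrite -mulNr !opprB -subrX1.
by rewrite gerBl exprn_ge0.
Qed.

Lemma geometric_sum_gt1 (R : realType) (x : R) (K : nat) :
  1 < x -> \sum_(k < K.+1) x ^+ k <= (1 - x^-1)^-1 * x ^+ K.
Proof.
move=> x1; have x0 : 0 < x by exact: lt_trans x1.
rewrite (reindex_inj rev_ord_inj)/=.
have -> : \sum_(k < K.+1) x ^+ (K.+1 - k.+1) =
          (\sum_(k < K.+1) x^-1 ^+ k) * x ^+ K.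
  rewrite mulr_suml; apply: eq_bigr => k _; rewrite subSS.
  have kK : (k <= K)%N by rewrite -ltnS.
  have -> : x ^+ K = x ^+ k * x ^+ (K - k) by rewrite -exprD subnKC.
  by rewrite mulrA -exprMn mulVf ?gt_eqF// expr1n mul1r.
rewrite ler_wpM2r ?exprn_ge0 ?(ltW x0)//; apply: geometric_sum_lt1.
by rewrite invr_ge0 ltW//= invf_lt1.
Qed.

(** * The sample numbers for a given finest level *)

(** The exponent [delta] below is the one for which the terms of the error sum
    and of the cost sum decay at the same rate, which is what a Lagrange
    multiplier condition asks for.  The sample numbers are rounded up to
    [truncn x + 1], not to the ceiling: this is positive without further
    argument, and the error bound stays true since [m^(-mu)] decreases. *)
Lemma sample_allocation (R : realType) (q beta mu gamma t : R) (K : nat)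
    (S := \sum_(k < K.+1) (q `^ ((beta - gamma * mu) / (1 + mu))) ^+ k) :
  0 < q < 1 -> 0 < beta -> 0 < mu -> 0 < gamma -> 0 < t ->
  exists M : nat -> nat,
    [/\ forall k, (0 < M k)%N,
        {homo M : j k / (j <= k)%N},
        \sum_(k < K.+1) (M (K - k)%N)%:R `^ (- mu) * (q ^+ k) `^ beta <= t &
        \sum_(k < K.+1) (M (K - k)%N)%:R * (q ^+ k) `^ (- gamma) <=
          t `^ (- mu^-1) * S `^ (1 + mu^-1)
          + \sum_(k < K.+1) (q `^ (- gamma)) ^+ k].
Proof.
move=> /andP[q0 q1] b0 m0 g0 t0.
have m1 : 1 + mu != 0 by rewrite gt_eqF// addr_gt0.
set theta := (beta - gamma * mu) / (1 + mu) in S *.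
pose delta := (beta + gamma) / (1 + mu).
have d0 : 0 < delta by rewrite divr_gt0// addr_gt0.
have S0 : 0 < S.
  rewrite /S big_ord_recl expr0 ltr_pwDl// sumr_ge0// => k _.
  by rewrite exprn_ge0// powR_ge0.
(* The solution of X^(-mu) S = t. *)
pose X := (S / t) `^ mu^-1.
have X0 : 0 < X by rewrite powR_gt0// divr_gt0.
pose x k := X * (q `^ delta) ^+ k.
have x0 k : 0 < x k by rewrite mulr_gt0// exprn_gt0// powR_gt0.
have qd1 : q `^ delta <= 1.
  by rewrite -(powRr0 q) ger_powR ?q0 ?ltW.
(* [M j] belongs to level [K - j], so it grows with [j] as [x] decreases; for
   [j > K] the truncated difference makes [M] constant. *)
exists (fun j => (Num.truncn (x (K - j)%N)).+1).
have xP k : x k <= (Num.truncn (x k)).+1%:R <= x k + 1.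
  have /andP[h1 h2] := truncn_itv (ltW (x0 k)).
  by rewrite ltW//= -natr1 lerD2r.
have pw s k : (q ^+ k) `^ s = (q `^ s) ^+ k by rewrite powR_exprAC ?ltW.
have qE (s r : R) k : (q `^ s) ^+ k * (q `^ r) ^+ k = (q `^ (s + r)) ^+ k.
  by rewrite -exprMn powRD ?(gt_eqF q0) ?implybT.
split => //.
- move=> j k jk; rewrite ltnS le_truncn// ler_wpM2l ?(ltW X0)//.
  by rewrite ler_wiXn2l// ?powR_ge0// leq_sub2l.
- apply: (@le_trans _ _ (X `^ (- mu) * S)).
    rewrite /S mulr_sumr ler_sum// => k _.
    have -> : (K - (K - k))%N = k by rewrite subKn// -ltnS.
    apply: (@le_trans _ _ (x k `^ (- mu) * (q ^+ k) `^ beta)).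
      rewrite ler_wpM2r ?powR_ge0// !powRN lef_pV2 ?posrE ?powR_gt0//.
      rewrite ge0_ler_powR ?nnegrE ?(ltW m0) ?(ltW (x0 k))//.
      by case/andP: (xP k).
    rewrite powRM ?exprn_ge0 ?powR_ge0 ?(ltW X0)// -mulrA ler_wpM2l ?powR_ge0//.
    rewrite powR_exprAC ?powR_ge0// -powRrM pw qE.
    suff -> : delta * - mu + beta = theta by [].
    by rewrite /delta /theta; field.
  rewrite /X -powRrM mulrN mulVf ?gt_eqF// powR_inv1 ?divr_ge0 ?(ltW S0) ?(ltW t0)//.
  by rewrite invf_div divfK// (gt_eqF S0).
- apply: (@le_trans _ _ (X * S + \sum_(k < K.+1) (q `^ (- gamma)) ^+ k)).
    rewrite /S mulr_sumr -big_split/= ler_sum// => k _.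
    have -> : (K - (K - k))%N = k by rewrite subKn// -ltnS.
    apply: (@le_trans _ _ ((x k + 1) * (q ^+ k) `^ (- gamma))).
      by rewrite ler_wpM2r ?powR_ge0//; case/andP: (xP k).
    rewrite mulrDl mul1r pw /x -mulrA qE.
    suff -> : delta + - gamma = theta by [].
    by rewrite /delta /theta; field.
  rewrite lerD2r /X powRM ?invr_ge0 ?(ltW S0) ?(ltW t0)// -(powR_inv1 (ltW t0)) -powRrM mulN1r.
  rewrite powRD ?(gt_eqF S0) ?implybT// powRr1 ?(ltW S0)//.
  by rewrite le_eqVlt; apply/orP; left; apply/eqP; ring.
Qed.

(** * The finest level *)

Lemma log_ge1 (R : realType) (eps : R) :
  0 < eps < expR (- 1) -> 1 <= `|ln eps|.
Proof.
move=> /andP[e0 e1].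
have : ln eps < -1 by rewrite -(expRK (-1 : R)) ltr_ln ?posrE ?expR_gt0.
by move=> l; rewrite ltr0_norm; lra.
Qed.

Lemma lt_expRN1_lt1 (R : realType) (eps : R) : eps < expR (- 1) -> eps < 1.
Proof. by move=> /lt_trans; apply; rewrite expR_lt1; lra. Qed.

(** The least [K] meeting the tolerance cannot overshoot it by more than the
    factor [q^alpha], because level [K - 1] misses it.  This reverse bound
    controls all quantities that grow with [K], and its logarithm gives the
    bound on the number of levels. *)
Lemma finest_level (R : realType) (A alpha q : R) :
  0 < A -> 0 < alpha -> 0 < q < 1 ->
  exists2 c : R, 0 < c & forall eps : R, 0 < eps < expR (- 1) ->
    exists K : nat,
      [/\ A * (q ^+ K) `^ alpha <= eps,
          (q ^+ K)^-1 <= c * eps `^ (- alpha^-1) &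
          K.+1%:R <= c * `|ln eps|].
Proof.
move=> A0 a0 /andP[q0 q1].
pose c1 := 1 + q^-1 * A `^ alpha^-1.
have c1_ge1 : 1 <= c1 by rewrite lerDl mulr_ge0 ?powR_ge0 ?invr_ge0 ?(ltW q0).
have c1_0 : 0 < c1 by exact: lt_le_trans c1_ge1.
have L0 : 0 < - ln q by rewrite oppr_gt0 ln_lt0// q0.
pose c2 := 1 + (ln c1 + alpha^-1) / - ln q.
have c2_ge0 : 0 <= c2.
  by rewrite addr_ge0// divr_ge0 ?(ltW L0)// addr_ge0 ?ln_ge0// invr_ge0 ltW.
exists (c1 + c2) => [|eps e01]; first by rewrite ltr_pwDl.
have l1 := @log_ge1 _ _ e01.
case/andP: e01 => e0 e1.
have e_lt1 := @lt_expRN1_lt1 _ _ e1.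
pose tau := (eps / A) `^ alpha^-1.
have tau0 : 0 < tau by rewrite powR_gt0// divr_gt0.
have : exists n, q ^+ n <= tau.
  have /cvgr0Pnorm_lt/(_ _ tau0) : (q ^+ n) @[n --> \oo] --> (0 : R).
    by apply: cvg_expr; rewrite ger0_norm// ltW.
  move=> [n _ /(_ n (leqnn n))/= H]; exists n.
  by rewrite ltW// (le_lt_trans _ H)// ler_norm.
move=> /ex_minnP[K Ktau Kmin]; exists K.
have qK0 : 0 < q ^+ K by rewrite exprn_gt0.
have H1 : (q ^+ K)^-1 <= c1 * eps `^ (- alpha^-1).
  have pe : 1 <= eps `^ (- alpha^-1).
    by rewrite -[leLHS](powRr0 eps) ger_powR ?e0 ?ltW// oppr_lt0 invr_gt0.
  (* For K = 0 there is no coarser level to compare with; then the left-hand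
     side is 1, which is why 1 is added in c1. *)
  case: K Ktau Kmin qK0 => [_ _ _|K _ Kmin _].
    by rewrite expr0 invr1 (le_trans c1_ge1)// ler_peMr// ltW.
  have tK : tau < q ^+ K by rewrite ltNge; apply/negP => /Kmin; rewrite ltnn.
  rewrite exprS invfM; apply: (@le_trans _ _ (q^-1 * tau^-1)).
    by rewrite ler_wpM2l ?invr_ge0 ?(ltW q0)// lef_pV2 ?posrE ?(ltW tK)// exprn_gt0.
  have -> : tau^-1 = A `^ alpha^-1 * eps `^ (- alpha^-1).
    rewrite /tau -powRN powRM ?invr_ge0 ?(ltW e0) ?(ltW A0)//.
    by rewrite -(powR_inv1 (ltW A0)) -powRrM mulN1r opprK mulrC.
  by rewrite mulrA ler_wpM2r ?powR_ge0// lerDr.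
split.
- rewrite -ler_pdivlMl// mulrC.
  apply: (@le_trans _ _ (tau `^ alpha)).
    by rewrite ge0_ler_powR ?nnegrE ?(ltW a0) ?(ltW tau0) ?(ltW qK0).
  by rewrite -powRrM mulVf ?gt_eqF// powRr1// divr_ge0 ?ltW.
- by rewrite (le_trans H1)// ler_wpM2r ?powR_ge0// lerDl.
- apply: (@le_trans _ _ (c2 * `|ln eps|)); last first.
    by rewrite ler_wpM2r// lerDr ltW.
  have le0 : ln eps < 0 by rewrite ln_lt0// e0.
  have H2 : K%:R * - ln q <= ln c1 + alpha^-1 * `|ln eps|.
    move: H1; rewrite -ler_ln ?posrE ?invr_gt0 ?mulr_gt0 ?powR_gt0//.
    rewrite lnM ?posrE ?powR_gt0// lnV ?posrE// lnXn// ln_powR.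
    by rewrite ltr0_norm// mulr_natl mulNrn mulrN mulNr.
  rewrite -natr1 /c2 mulrDl mul1r addrC lerD//.
  rewrite mulrAC ler_pdivlMr// (le_trans H2)// mulrDl lerD2r ler_peMr//.
  exact: ln_ge0.
Qed.

(** * Comparison with the cost rates *)

(** The left-hand side is the order of the bound for the cost of one sample on
    the finest level, which has to be paid however few samples suffice; this is
    where the condition relating [alpha] to [beta] and [mu * gamma] enters. *)
Lemma finest_sample_rate (R : realType) (alpha beta mu gamma eps : R) :
  0 < alpha -> 0 < mu -> Num.min beta (mu * gamma) <= alpha ->
  0 < eps < expR (- 1) ->
  eps `^ (- (gamma / alpha)) <= cost_rate alpha beta mu gamma eps.
Proof.
move=> a0 m0 hmin e01; have l1 := @log_ge1 _ _ e01.
case/andP: e01 => e0 /lt_expRN1_lt1 e1.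
have e01 : 0 < eps <= 1 by rewrite e0 ltW.
rewrite /cost_rate; case: ltrgtP => [mb|bm|bm].
- rewrite ger_powR// lerN2 ler_pdivrMr// ler_pdivlMl//.
  by move: hmin; rewrite min_r ?(ltW mb).
- rewrite ger_powR//.
  (* The exponents differ by (alpha - beta) / (alpha * mu). *)
  have : gamma / alpha <= mu^-1 + (gamma * mu - beta) / (alpha * mu).
    have -> : mu^-1 + (gamma * mu - beta) / (alpha * mu)
            = gamma / alpha + (alpha - beta) / (alpha * mu).
      by field; rewrite !gt_eqF.
    rewrite lerDl divr_ge0 ?mulr_ge0 ?(ltW a0) ?(ltW m0)// subr_ge0.
    by move: hmin; rewrite min_l ?(ltW bm).
  by lra.
- apply: (@le_trans _ _ (eps `^ (- mu^-1))).
    rewrite ger_powR// lerN2 ler_pdivrMr// ler_pdivlMl//.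
    by move: hmin; rewrite -bm minxx bm.
  rewrite ler_peMr ?powR_ge0//.
  rewrite -(powRr0 `|ln eps|) ler_powR// addr_ge0// invr_ge0 ltW//.
Qed.

(** The sum is bounded, dominated by its last term or has constant terms,
    according to the sign of the exponent of [q]; the hypotheses on [K] then
    turn it into a function of [eps]. *)
Lemma weighted_sample_rate (R : realType) (alpha beta mu gamma q c0 : R) :
  0 < alpha -> 0 < mu -> 0 < q < 1 -> 0 < c0 ->
  exists2 c : R, 0 < c & forall (eps : R) (K : nat), 0 < eps ->
    (q ^+ K)^-1 <= c0 * eps `^ (- alpha^-1) -> K.+1%:R <= c0 * `|ln eps| ->
    eps `^ (- mu^-1) *
      (\sum_(k < K.+1) (q `^ ((beta - gamma * mu) / (1 + mu))) ^+ k)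
        `^ (1 + mu^-1)
    <= c * cost_rate alpha beta mu gamma eps.
Proof.
move=> a0 m0 q01 c00; have /andP[q0 q1] := q01.
have m1 : 0 < 1 + mu by rewrite addr_gt0.
have p0 : 0 < 1 + mu^-1 by rewrite addr_gt0// invr_gt0.
set theta := (beta - gamma * mu) / (1 + mu).
have x0 : 0 < q `^ theta by rewrite powR_gt0.
have sum0 K : 0 <= \sum_(k < K.+1) (q `^ theta) ^+ k.
  by rewrite sumr_ge0// => k _; rewrite exprn_ge0// ltW.
have mono (r s : R) : 0 <= r -> r <= s -> r `^ (1 + mu^-1) <= s `^ (1 + mu^-1).
  move=> r0 rs; rewrite ge0_ler_powR ?nnegrE ?(ltW p0)//.
  exact: le_trans rs.
rewrite /cost_rate; case: ltrgtP => [mb|bm|bm].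
- have t0 : 0 < theta by rewrite divr_gt0// subr_gt0 mulrC.
  have x1 : q `^ theta < 1.
    exact: powR_lt1.
  exists ((1 - q `^ theta)^-1 `^ (1 + mu^-1)).
    by rewrite powR_gt0// invr_gt0 subr_gt0.
  move=> eps K e0 _ _; rewrite mulrC ler_wpM2r ?powR_ge0// mono//.
  by rewrite geometric_sum_lt1// ltW.
- have t0 : 0 < - theta.
    by rewrite oppr_gt0 pmulr_llt0 ?invr_gt0// subr_lt0 mulrC.
  have x1 : 1 < q `^ theta.
    rewrite -[theta]opprK powRN invf_gt1 ?powR_gt0//.
    exact: powR_lt1.
  have C0 : 0 < (1 - (q `^ theta)^-1)^-1.
    by rewrite invr_gt0 subr_gt0 invf_lt1.
  (* The exponent -theta * (1 + 1/mu), which is left when the last term of the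
     sum is raised to the power 1 + 1/mu. *)
  pose s := (gamma * mu - beta) / mu.
  have s0 : 0 < s by rewrite divr_gt0// subr_gt0 mulrC.
  exists ((1 - (q `^ theta)^-1)^-1 `^ (1 + mu^-1) * c0 `^ s).
    by rewrite mulr_gt0// powR_gt0.
  move=> eps K e0 HK _.
  have -> : - mu^-1 - (gamma * mu - beta) / (alpha * mu)
          = - alpha^-1 * s + - mu^-1.
    by rewrite /s; field; rewrite !gt_eqF.
  rewrite [eps `^ (_ + _)]powRD ?(gt_eqF e0) ?implybT//.
  rewrite [leRHS]mulrA [leLHS]mulrC ler_wpM2r ?powR_ge0//.
  apply: (le_trans (mono _ _ (sum0 K) (@geometric_sum_gt1 _ _ K x1))).
  rewrite powRM ?exprn_ge0 ?(ltW C0) ?(ltW x0)// -mulrA ler_wpM2l ?powR_ge0//.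
  have -> : ((q `^ theta) ^+ K) `^ (1 + mu^-1) = (q ^+ K)^-1 `^ s.
    rewrite -powR_exprAC ?ltW// -powRrM -(powR_inv1 (exprn_ge0 _ (ltW q0))).
    rewrite -powRrM; congr (_ `^ _); rewrite /theta /s.
    by field; rewrite !gt_eqF.
  rewrite (powRrM _ _ s) -powRM ?powR_ge0 ?(ltW c00)//.
  by rewrite ge0_ler_powR ?(ltW g0) ?(ltW s0)// nnegrE ?invr_ge0
    ?exprn_ge0 ?mulr_ge0 ?powR_ge0 ?(ltW q0) ?(ltW c00).
- exists (c0 `^ (1 + mu^-1)); first by rewrite powR_gt0.
  move=> eps K e0 _ HK; rewrite mulrCA ler_wpM2l ?powR_ge0//.
  rewrite -powRM ?(ltW c00)//; apply: mono => //.
  rewrite (le_trans _ HK)// -[K.+1 in leRHS]card_ord -sum1_card natr_sum ler_sum// => k _.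
  have -> : theta = 0 by rewrite /theta (_ : _ - _ = 0) ?mul0r//; lra.
  by rewrite powRr0 expr1n.
Qed.

(** The numerical content of the theorem: [A], [B] and [G] stand for the
    constants of the discretisation error, the interpolation error and the cost
    per sample when the mesh width is normalised to [q ^+ k].  Each of the two
    error contributions gets half of [eps]. *)
Lemma multilevel_parameters (R : realType)
    (alpha beta mu gamma q A B G : R) :
  0 < alpha -> 0 < beta -> 0 < mu -> 0 < gamma ->
  Num.min beta (mu * gamma) <= alpha ->
  0 < q < 1 -> 0 < A -> 0 < B -> 0 < G ->
  exists2 c : R, 0 < c & forall eps : R, 0 < eps < expR (- 1) ->
    exists (K : nat) (M : nat -> nat),
      [/\ forall k, (0 < M k)%N,
          {homo M : j k / (j <= k)%N},
          A * (q ^+ K) `^ alpha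
          + \sum_(k < K.+1) B * (M (K - k)%N)%:R `^ (- mu) * (q ^+ k) `^ beta
            <= eps &
          \sum_(k < K.+1) (M (K - k)%N)%:R * (G * (q ^+ k) `^ (- gamma))
            <= c * cost_rate alpha beta mu gamma eps].
Proof.
move=> a0 b0 m0 g0 hmin q01 A0 B0 G0; have /andP[q0 q1] := q01.
have A2 : 0 < 2 * A by rewrite mulr_gt0.
(* Twice A, so that the discretisation error is at most eps / 2. *)
have [c0 c00 Hlevel] := @finest_level R (2 * A) alpha q A2 a0 q01.
have [c1 c10 Hweighted] :=
  @weighted_sample_rate R alpha beta mu gamma q c0 a0 m0 q01 c00.
pose x := q `^ (- gamma).
have x1 : 1 < x.
  rewrite /x powRN invf_gt1 ?powR_gt0//.
  exact: powR_lt1.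
pose g := (1 - x^-1)^-1.
have gpos : 0 < g by rewrite invr_gt0 subr_gt0 invf_lt1// (lt_trans _ x1).
pose b := (2 * B) `^ mu^-1.
have bpos : 0 < b by rewrite powR_gt0// mulr_gt0.
exists (G * (b * c1 + g * c0 `^ gamma)).
  by rewrite mulr_gt0// addr_gt0// mulr_gt0// powR_gt0.
move=> eps e01; have [K [HK1 HK2 HK3]] := Hlevel _ e01.
have hfin := @finest_sample_rate _ _ _ _ _ _ a0 m0 hmin e01.
have /andP[e0 e1] := e01.
have t0 : 0 < eps / (2 * B) by rewrite divr_gt0// mulr_gt0.
have [M [M0 Mle Merr Mcost]] :=
  @sample_allocation R q beta mu gamma (eps / (2 * B)) K q01 b0 m0 g0 t0.
exists K, M; split => //.
- have -> : \sum_(k < K.+1) B * (M (K - k)%N)%:R `^ (- mu) * (q ^+ k) `^ beta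
          = B * \sum_(k < K.+1) (M (K - k)%N)%:R `^ (- mu) * (q ^+ k) `^ beta.
    by rewrite mulr_sumr; apply: eq_bigr => k _; rewrite mulrA.
  have : B * \sum_(k < K.+1) (M (K - k)%N)%:R `^ (- mu) * (q ^+ k) `^ beta
      <= eps / 2.
    apply: (le_trans (ler_wpM2l (ltW B0) Merr)).
    rewrite le_eqVlt; apply/orP; left; apply/eqP; field.
    by rewrite gt_eqF.
  by move: HK1; rewrite -mulrA; lra.
- have -> : \sum_(k < K.+1) (M (K - k)%N)%:R * (G * (q ^+ k) `^ (- gamma))
          = G * \sum_(k < K.+1) (M (K - k)%N)%:R * (q ^+ k) `^ (- gamma).
    by rewrite mulr_sumr; apply: eq_bigr => k _; rewrite mulrCA.
  rewrite -!mulrA ler_wpM2l ?(ltW G0)// (le_trans Mcost)// [leRHS]mulrDl lerD//.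
    have -> : (eps / (2 * B)) `^ (- mu^-1) = b * eps `^ (- mu^-1).
      rewrite powRM ?(ltW e0) ?invr_ge0 ?mulr_ge0 ?(ltW B0)// mulrC.
      rewrite -(powR_inv1 (mulr_ge0 _ (ltW B0)))// -powRrM mulN1r opprK//.
    by rewrite -!mulrA ler_wpM2l ?(ltW bpos)// Hweighted.
  apply: (le_trans (@geometric_sum_gt1 _ _ K x1)).
  rewrite -!mulrA ler_wpM2l ?(ltW gpos)//.
  apply: (@le_trans _ _ (c0 `^ gamma * eps `^ (- (gamma / alpha)))); last first.
    by rewrite ler_wpM2l ?powR_ge0.
  have -> : - (gamma / alpha) = - alpha^-1 * gamma by rewrite mulNr mulrC.
  rewrite [eps `^ _]powRrM -powRM ?powR_ge0 ?(ltW c00)//.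
  rewrite /x -powR_exprAC ?(ltW q0)// -mulN1r powRrM powR_inv1 ?exprn_ge0 ?(ltW q0)//.
  by rewrite ge0_ler_powR ?(ltW g0) ?(ltW s0)// nnegrE ?invr_ge0
    ?exprn_ge0 ?mulr_ge0 ?powR_ge0 ?(ltW q0) ?(ltW c00).
Qed.

(** * The error of the multilevel approximation *)

Lemma measurable_Gamma (R : realType) (N : nat) : measurable (@Gamma R N).
Proof.
have -> : @Gamma R N =
    \bigcap_(i in [set: 'I_N]) (@rV_coord R N i @^-1` `[-1, 1]).
  by apply/seteqP; split=> [x Gx i _|x Gx i]; [exact: Gx|exact: (Gx i I)].
apply: fin_bigcap_measurable => // i _; rewrite -[X in measurable X]setTI.
exact: measurable_rV_coord.
Qed.

Lemma expectD (R : realType) (N : nat) (rho g1 g2 : 'rV[R]_N -> R) :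
  expectation_exists rho g1 -> expectation_exists rho g2 ->
  expectation_exists rho (fun y => g1 y + g2 y) /\
  expect rho (fun y => g1 y + g2 y) = expect rho g1 + expect rho g2.
Proof.
move=> i1 i2; have mG := @measurable_Gamma R N; split.
  rewrite /expectation_exists.
  under eq_fun do rewrite mulrDl EFinD.
  exact: integrableD.
rewrite /expect -RintegralD//; apply: eq_Rintegral => y _.
by rewrite mulrDl.
Qed.

(** Existence of the expectation is part of the conclusion because the
    induction on [n] uses it to split off the next summand. *)
Lemma expect_sum_le (R : realType) (N : nat) (rho g0 : 'rV[R]_N -> R)
    (g : nat -> 'rV[R]_N -> R) (b0 : R) (b : nat -> R) (n : nat) :
  expectation_exists rho g0 -> (forall k, expectation_exists rho (g k)) ->
  `|expect rho g0| <= b0 -> (forall k, (k < n)%N -> `|expect rho (g k)| <= b k) ->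
  expectation_exists rho (fun y => g0 y + \sum_(k < n) g k y) /\
  `|expect rho (fun y => g0 y + \sum_(k < n) g k y)| <= b0 + \sum_(k < n) b k.
Proof.
move=> i0 ig h0; elim: n => [_|n IH hb].
  have -> : (fun y => g0 y + \sum_(k < 0) g k y) = g0.
    by apply/funext => y; rewrite big_ord0 addr0.
  by rewrite big_ord0 addr0.
have [i1 h1] := IH (fun k kn => hb k (ltnW kn)).
have -> : (fun y => g0 y + \sum_(k < n.+1) g k y) =
          (fun y => (g0 y + \sum_(k < n) g k y) + g n y).
  by apply/funext => y; rewrite big_ord_recr/= addrA.
have [i2 ->] := expectD _ _ _ _ _ i1 (ig n).
split=> //; rewrite big_ord_recr/= addrA.
by rewrite (le_trans (ler_normD _ _))// lerD// hb.
Qed.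

Lemma sum_level_difference (R : realType) (d N : nat)
    (psi : ('rV[R]_d -> R) -> R) (uh : nat -> 'rV[R]_N -> 'rV[R]_d -> R)
    (K : nat) (y : 'rV[R]_N) :
  psi (fun=> 0) = 0 ->
  \sum_(k < K.+1) level_difference psi uh k y = psi (uh K y).
Proof.
move=> psi0; elim: K => [|K IH]; first by rewrite big_ord1 /level_difference/= psi0 subr0.
by rewrite big_ord_recr/= IH /level_difference addrC subrK.
Qed.

(** By telescoping, [psi(u)] minus the multilevel approximation is
    [psi(u) - psi(u_{h_K})] plus the sum of the interpolation errors of the
    level differences. *)
Lemma multilevel_error_le (R : realType) (d N : nat) (rho : 'rV[R]_N -> R)
    (psi : ('rV[R]_d -> R) -> R) (u : 'rV[R]_N -> 'rV[R]_d -> R)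
    (uh : nat -> 'rV[R]_N -> 'rV[R]_d -> R)
    (I : nat -> ('rV[R]_N -> R) -> ('rV[R]_N -> R))
    (K : nat) (M : nat -> nat) (b0 : R) (b : nat -> nat -> R)
    (hpsi0 : psi (fun=> 0) = 0)
    (hM : forall k, (0 < M k)%N)
    (hE1 : expectation_exists rho (fun y => psi (u y) - psi (uh K y)))
    (hE2 : forall k m, (0 < m)%N ->
      expectation_exists rho (fun y =>
        level_difference psi uh k y - I m (level_difference psi uh k) y))
    (h1 : `|expect rho (fun y => psi (u y) - psi (uh K y))| <= b0)
    (h2 : forall k m, (0 < m)%N ->
      `|expect rho (fun y =>
          level_difference psi uh k y - I m (level_difference psi uh k) y)|
      <= b k m) :
  `|expect rho (fun y => psi (u y) - multilevel psi uh I K M y)|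
  <= b0 + \sum_(k < K.+1) b k (M (K - k)%N).
Proof.
pose g k y := level_difference psi uh k y
              - I (M (K - k)%N) (level_difference psi uh k) y.
have -> : (fun y => psi (u y) - multilevel psi uh I K M y) =
          (fun y => (psi (u y) - psi (uh K y)) + \sum_(k < K.+1) g k y).
  apply/funext => y; rewrite /g sumrB sum_level_difference//.
  by rewrite addrA subrK.
have ig k : expectation_exists rho (g k) by exact: hE2.
by have [] := @expect_sum_le _ _ rho _ g b0 (fun k => b k (M (K - k)%N)) K.+1
  hE1 ig h1 (fun k _ => h2 k _ (hM _)).
Qed.

(** * The complexity theorem *)

Theorem proposition4p5 (R : realType) (d N : nat)
  (hd : (0 < d <= 3)%N) (hN : (0 < N)%N)
  (D : set 'rV[R]_d) (hD : bounded_lipschitz_domain D)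
  (rho : 'rV[R]_N -> R) (hrho : product_density rho) (hrho_bdd : ess_bounded rho)
  (a : 'rV[R]_N -> 'rV[R]_d -> R) (amin amax : R)
  (ha_meas : measurable_fun (@Gamma R N `*` closure D) (fun q => a q.1 q.2))
  (hamin : 0 < amin)
  (ha : rho_ae rho (fun y => forall x, closure D x -> amin <= a y x <= amax))
  (f : 'rV[R]_N -> ('rV[R]_d -> R) -> R)
  (hf : bochner_L2rho rho (Hminus1 D) (Hminus1_norm D) f)
  (u : 'rV[R]_N -> 'rV[R]_d -> R)
  (huL2 : bochner_L2rho rho (H10 D) (H1norm D) u)
  (huC0 : continuous_on_Gamma (H10 D) (H1norm D) u)
  (hu : rho_ae rho (fun y => galerkin_solution D (H10 D) (a y) (f y) (u y)))
  (eta : nat) (heta : (1 < eta)%N) (h0 : R) (hh0 : 0 < h0)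
  (h : nat -> R) (hh : forall k, h k = eta%:R ^- k * h0)
  (p : nat) (hp : (0 < p)%N)
  (T : nat -> set ('I_d.+1 -> 'rV[R]_d))
  (hT : forall k, triangulation D (T k))
  (hT_width : forall k, max_mesh_width (T k) (h k))
  (hT_reg : shape_regular T)
  (V : nat -> set ('rV[R]_d -> R))
  (hV : forall k, fe_space p D (T k) (V k))
  (hV_nested : forall k, V k `<=` V k.+1)
  (uh : nat -> 'rV[R]_N -> 'rV[R]_d -> R)
  (huh_V : forall k y, Gamma y -> V k (uh k y))
  (huh : forall k, rho_ae rho (fun y => galerkin_solution D (V k) (a y) (f y) (uh k y)))
  (psi : ('rV[R]_d -> R) -> R)
  (hpsi : forall v w, H10 D v -> H10 D w -> ae_eq_on D v w -> psi v = psi w)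
  (hpsi0 : psi (fun=> 0) = 0)
  (I : nat -> ('rV[R]_N -> R) -> ('rV[R]_N -> R))
  (hI : forall M, (0 < M)%N -> interpolation_operator rho M (I M))
  (C : nat -> R)
  (alpha beta mu gamma Cs CI Czeta Cc : R)
  (halpha : 0 < alpha) (hbeta : 0 < beta) (hmu : 0 < mu) (hgamma : 0 < gamma)
  (hCs : 0 < Cs) (hCI : 0 < CI) (hCzeta : 0 < Czeta) (hCc : 0 < Cc)
  (zeta : ('rV[R]_N -> R) -> R)
  (hE1 : forall k, expectation_exists rho (fun y => psi (u y) - psi (uh k y)))
  (hE2 : forall k M, (0 < M)%N ->
     expectation_exists rho (fun y =>
       level_difference psi uh k y - I M (level_difference psi uh k) y))
  (hrates : Num.min beta (mu * gamma) <= alpha)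
  (F1 : forall k,
     `|expect rho (fun y => psi (u y) - psi (uh k y))| <= Cs * h k `^ alpha)
  (F2 : forall k M, (0 < M)%N ->
     `|expect rho (fun y =>
         level_difference psi uh k y - I M (level_difference psi uh k) y)|
     <= CI * M%:R `^ (- mu) * zeta (level_difference psi uh k))
  (F3 : forall k, zeta (level_difference psi uh k) <= Czeta * h k `^ beta)
  (F4 : forall k, C k = Cc * h k `^ (- gamma)) :
  exists2 c : R, 0 < c &
    forall eps : R, 0 < eps < expR (- 1) ->
    exists (K : nat) (M : nat -> nat),
      [/\ forall k, (k <= K)%N -> (0 < M k)%N,
          forall j k, (j <= k <= K)%N -> (M j <= M k)%N,
          `|expect rho (fun y => psi (u y) - multilevel psi uh I K M y)| <= eps &
          total_cost C K M <= c * cost_rate alpha beta mu gamma eps].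
Proof.
pose q : R := eta%:R^-1.
have q01 : 0 < q < 1.
  by rewrite invr_gt0 ltr0n (ltn_trans _ heta)//= invf_lt1 ?ltr1n// ltr0n (ltn_trans _ heta).
have /andP[q0 q1] := q01.
have hE k s : h k `^ s = h0 `^ s * (q ^+ k) `^ s.
  by rewrite hh -exprVn -/q mulrC powRM ?exprn_ge0 ?ltW.
have [c c0 H] := @multilevel_parameters R alpha beta mu gamma q
  (Cs * h0 `^ alpha) (CI * Czeta * h0 `^ beta) (Cc * h0 `^ (- gamma))
  halpha hbeta hmu hgamma hrates q01
  (mulr_gt0 hCs (powR_gt0 _ hh0))
  (mulr_gt0 (mulr_gt0 hCI hCzeta) (powR_gt0 _ hh0))
  (mulr_gt0 hCc (powR_gt0 _ hh0)).
exists c => // eps e01; have [K [M [M0 Mle Merr Mcost]]] := H _ e01.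
exists K, M; split => [k _|j k /andP[jk _]||].
- exact: M0.
- exact: Mle.
- apply: le_trans Merr.
  apply: (@multilevel_error_le _ _ _ _ _ _ _ _ _ _ (Cs * h0 `^ alpha * (q ^+ K) `^ alpha)
    (fun k m => CI * Czeta * h0 `^ beta * m%:R `^ (- mu) * (q ^+ k) `^ beta)) => //.
    by rewrite -mulrA -hE.
  move=> k m m0; apply: (le_trans (F2 k m m0)).
  have -> : CI * Czeta * h0 `^ beta * m%:R `^ (- mu) * (q ^+ k) `^ beta
          = CI * m%:R `^ (- mu) * (Czeta * h k `^ beta) by rewrite hE; ring.
  by apply: ler_wpM2l (F3 k); rewrite mulr_ge0 ?powR_ge0 ?(ltW hCI).
- apply: le_trans Mcost; rewrite /total_cost le_eqVlt; apply/orP; left; apply/eqP.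
  by apply: eq_bigr => k _; rewrite F4 hE !mulrA.
Qed.
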